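(* Let $G$ be a partial graph with a local coloring and with at least one vertex. If $G$ has no cusp-free cycle, then $G$ has a splitting vertex.
   Context: A partial graph is a triple $(\mathcal V,\mathcal E,\psi)$ of disjoint finite sets of vertices and edges and a function $\psi$ giving each edge a set of at most two endpoints. A path is an alternating sequence $(v_0,e_1,v_1,\dots,e_n,v_n)$ with the endpoints of $e_i$ exactly $v_{i-1}\neq v_i$; simple if edges are pairwise distinct and vertices pairwise distinct except possibly $v_0=v_n$; a cycle is a simple closed ($v_0=v_n$) path with at least one edge. A local coloring $\mathsf c$ assigns a color to each pair $(e,w)$ with $w$ an endpoint of $e$. A cusp is a triple $(e,w,f)$ of distinct edges incident to $w$ with $\mathsf c(e,w)=\mathsf c(f,w)$. A cusp of a cycle is a cusp formed by two consecutive edges of the cycle and their common vertex (including the last edge, the source and the first edge). A cycle is cusp-free if it has no cusp. A vertex $v$ is splitting if every cycle containing $v$ has a cusp at $v$. *)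

(* Defs.v *)
From mathcomp Require Import all_boot.
Set Implicit Arguments.
Unset Strict Implicit.
Unset Printing Implicit Defensive.

Record partial_graph := PartialGraph {
  vertex : finType;
  edge : finType;
  ends : edge -> {set vertex};
  ends_le2 : forall e, #|ends e| <= 2
}.

(* Colors are only given to pairs (e, w) with w an endpoint of e. *)
Definition local_coloring (G : partial_graph) (C : Type) :=
  forall (e : edge G) (w : vertex G), w \in ends e -> C.

Definition cusp (G : partial_graph) (C : Type) (c : local_coloring G C)
    (e : edge G) (w : vertex G) (f : edge G) : Prop :=
  e <> f /\
  exists (we : w \in ends e) (wf : w \in ends f), c e w we = c f w wf.

(* The alternating sequence (v_0, e_1, v_1, ..., e_n, v_n) is encoded as
   source v_0 and steps [:: (e_1, v_1); ...; (e_n, v_n)]. *)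
Record altseq (G : partial_graph) := AltSeq {
  source : vertex G;
  steps : seq (edge G * vertex G)
}.

Definition vertices (G : partial_graph) (p : altseq G) : seq (vertex G) :=
  source p :: [seq x.2 | x <- steps p].

Definition edges (G : partial_graph) (p : altseq G) : seq (edge G) :=
  [seq x.1 | x <- steps p].

Definition target (G : partial_graph) (p : altseq G) : vertex G :=
  last (source p) [seq x.2 | x <- steps p].

Fixpoint path_from (G : partial_graph) (v : vertex G)
    (s : seq (edge G * vertex G)) : bool :=
  if s is (e, w) :: s' then
    [&& v != w, ends e == [set v; w] & path_from w s']
  else true.

Definition is_path (G : partial_graph) (p : altseq G) : bool :=
  path_from (source p) (steps p).

Definition simple (G : partial_graph) (p : altseq G) : Prop :=
  uniq (edges p) /\
  forall i j : nat, i < j -> j <= size (steps p) ->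
    nth (source p) (vertices p) i = nth (source p) (vertices p) j ->
    i = 0 /\ j = size (steps p).

Definition is_cycle (G : partial_graph) (p : altseq G) : Prop :=
  [/\ is_path p, simple p, source p = target p & 0 < size (steps p)].

Fixpoint corners (G : partial_graph) (s : seq (edge G * vertex G)) :
    seq (edge G * vertex G * edge G) :=
  if s is (e, w) :: s' then
    if s' is (f, _) :: _ then (e, w, f) :: corners s' else [::]
  else [::].

(* Repeating the first step at the end adds the corner (e_n, v_n, e_1), which
   for a closed path is the one at the source v_0 = v_n. *)
Definition cycle_corners (G : partial_graph) (p : altseq G) :
    seq (edge G * vertex G * edge G) :=
  if steps p is x :: _ then corners (rcons (steps p) x) else [::].

Definition has_cusp_at (G : partial_graph) (C : Type) (c : local_coloring G C)
    (p : altseq G) (w : vertex G) : Prop :=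
  exists e f : edge G, (e, w, f) \in cycle_corners p /\ cusp c e w f.

Definition cusp_free (G : partial_graph) (C : Type) (c : local_coloring G C)
    (p : altseq G) : Prop :=
  ~ exists w : vertex G, has_cusp_at c p w.

Definition splitting (G : partial_graph) (C : Type) (c : local_coloring G C)
    (v : vertex G) : Prop :=
  forall p : altseq G, is_cycle p -> v \in vertices p -> has_cusp_at c p v.

(* Main.v *)
Require Import Defs.
From mathcomp Require Import all_boot boolp zify.
Set Implicit Arguments.
Unset Strict Implicit.
Unset Printing Implicit Defensive.

(* A dart is an edge traversed in a given direction.  Say that a dart d precedes
   a dart e when some simple cusp-free path leaves the target v of d with a
   colour other than the one of d at v, ends with e, and is never met again by a
   simple cusp-free path leaving the target u of e with a colour other than the
   one of e at u.  Concatenation of paths makes this a strict order on a finite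
   set; take a maximal d.
   If v were not splitting, some cycle through v would have no cusp at v and,
   up to reversal, start from v with a colour other than the one of d.  Choose
   one with as few cusps as possible, and follow it up to its first cusp, at the
   end u of a dart e.  A cusp-free path leaving u with another colour cannot come
   back to the cycle: at the first vertex where it does, it either closes a
   cusp-free cycle or allows rerouting the cycle with fewer cusps.  Hence d
   precedes e, a contradiction. *)

(** * Sequences and finite strict orders *)

Lemma cat_uniq_disjoint (T : eqType) (s1 s2 : seq T) :
  uniq s1 -> uniq s2 -> {in s1, forall y, y \notin s2} -> uniq (s1 ++ s2).
Proof.
move=> u1 u2 dis; rewrite cat_uniq u1 u2 andbT /=.
by apply/hasPn => y ys2; apply/negP => /dis; rewrite ys2.
Qed.

Lemma cycle_cat_cons (T : Type) (e : rel T) (a : T) s (b : T) t :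
  cycle e ((a :: s) ++ b :: t) =
  [&& path e a s, e (last a s) b, path e b t & e (last b t) a].
Proof. by rewrite /= rcons_cat cat_path /= rcons_path. Qed.

Lemma mem_map_split (T : Type) (U : eqType) (f : T -> U) (y : U) (s : seq T) :
  y \in map f s -> exists s1 x s2, s = rcons s1 x ++ s2 /\ f x = y.
Proof.
elim: s => // x s IHs /[!inE] /orP[/eqP->|/IHs[s1 [x' [s2 [-> <-]]]]].
  by exists [::], x, s.
by exists (x :: s1), x', s2.
Qed.

Lemma first_in (T : Type) (a : pred T) (s : seq T) : has a s ->
  exists s1 x s2, [/\ s = rcons s1 x ++ s2, a x & ~~ has a s1].
Proof. by case/split_find => x s1 s2 ax nas1; exists s1, x, s2. Qed.

(** Maximise the size of [below x]: [r x y] would make [below x] a proper subset of [below y], since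
    [x] lies only in the latter. *)
Lemma max_strict_order (T : finType) (r : T -> T -> Prop) (x0 : T) :
  (forall x, ~ r x x) -> (forall x y z, r x y -> r y z -> r x z) ->
  exists x, forall y, ~ r x y.
Proof.
move=> r_irr r_trans; pose below x := [set y | `[< r y x >]].
case: (@arg_maxnP T x0 predT (fun x => #|below x|)) => // x _ max_x.
exists x => y rxy; have /= := max_x y isT; rewrite leqNgt => /negP; apply.
apply: proper_card; apply/properP; split.
  by apply/subsetP => z; rewrite !inE => /asboolP rzx; apply/asboolP/(r_trans _ x).
by exists x; rewrite inE; [apply/asboolP | apply/asboolP/r_irr].
Qed.

Lemma uniq_map_inj (T U : eqType) (f : T -> U) (s : seq T) :
  uniq (map f s) -> {in s &, injective f}.
Proof.
elim: s => // a s IHs /= /andP[fa us] x y; rewrite !inE.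
case/predU1P=> [->|xs] /predU1P[->|ys] // E; last exact: IHs.
  by rewrite E map_f in fa.
by rewrite -E map_f in fa.
Qed.

(** * Abstract darts with a colour at each end *)

Section Darts.

Variables (V K : eqType) (D : finType).
Variables (src tgt : D -> V) (out inn : D -> K) (flip : D -> D).
Hypothesis src_flip : forall d, src (flip d) = tgt d.
Hypothesis tgt_flip : forall d, tgt (flip d) = src d.
Hypothesis out_flip : forall d, out (flip d) = inn d.
Hypothesis inn_flip : forall d, inn (flip d) = out d.

Definition link (d e : D) := tgt d == src e.
(** Only colours are compared, so turning back from [d] to [flip d] is cuspidal too; hence [step]
    excludes it. *)
Definition cuspidal (d e : D) := inn d == out e.
Definition step (d e : D) := link d e && ~~ cuspidal d e.

Definition reversal (s : seq D) := rev (map flip s).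

Definition cusp_free_cycle (s : seq D) :=
  [/\ 0 < size s, cycle step s & uniq (map tgt s)].

(* In this definition, in precedes and in cycle_from, the dart d is not part of
   the path: it fixes the starting point tgt d and forbids the colour inn d
   there. *)
Definition simple_from (d : D) (s : seq D) :=
  path step d s && uniq (map tgt (d :: s)).

Definition precedes (d e : D) := exists s,
  [/\ 0 < size s, simple_from d s, last d s = e &
      forall t, simple_from e t ->
        {in map tgt t, forall y, y \notin map tgt (d :: s)}].

Definition cycle_from (d : D) (s : seq D) :=
  [/\ path link d s, uniq (map tgt s), 0 < size s, tgt (last d s) = tgt d &
      ~~ cuspidal d (head d s) && ~~ cuspidal (last d s) (head d s)].

(** Under [cycle_from d s] this is the number of cusps of the cycle: the corner after [d] and the
    closing corner are not cuspidal. *)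
Definition cusps (d : D) (s : seq D) := count id (pairmap cuspidal d s).

Lemma cusps_cat d s1 s2 :
  cusps d (s1 ++ s2) = cusps d s1 + cusps (last d s1) s2.
Proof. by rewrite /cusps pairmap_cat count_cat. Qed.

Lemma path_step d s : path step d s = path link d s && (cusps d s == 0).
Proof.
elim: s d => //= e s IHs d; rewrite IHs /step /cusps /=.
by case: link; case: path; case: cuspidal.
Qed.

Lemma path_step_link d s : path step d s -> path link d s.
Proof. by rewrite path_step => /andP[]. Qed.

Lemma path_step_cusps d s : path step d s -> cusps d s = 0.
Proof. by rewrite path_step => /andP[_ /eqP]. Qed.

Lemma reversal_ends y s :
  exists2 t, reversal (y :: s) = flip (last y s) :: t
           & last (flip (last y s)) t = flip y.
Proof.
exists (reversal (belast y s)).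
  by rewrite lastI /reversal map_rcons rev_rcons.
rewrite -[LHS](last_cons y) -rev_rcons -map_rcons -lastI /= rev_cons.
by rewrite last_rcons.
Qed.

Lemma sorted_step_reversal s : sorted step (reversal s) = sorted step s.
Proof.
rewrite rev_sorted sorted_map; case: s => //= x s; apply: eq_path => a b /=.
rewrite /step /link /cuspidal tgt_flip src_flip inn_flip out_flip.
by rewrite eq_sym (eq_sym (out b)).
Qed.

Lemma cycle_link_reversal s : cycle link (reversal s) = cycle link s.
Proof.
rewrite rev_cycle cycle_map; apply: eq_cycle => a b.
by rewrite /= /link tgt_flip src_flip eq_sym.
Qed.

Lemma map_src d s : path link d s ->
  rcons (map src s) (tgt (last d s)) = tgt d :: map tgt s.
Proof. by elim: s d => //= x s IHs d /andP[/eqP-> /IHs->]. Qed.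

Lemma map_tgt_reversal s : map tgt (reversal s) = rev (map src s).
Proof. by rewrite /reversal map_rev -map_comp; congr rev; apply: eq_map => x /=. Qed.

(** * The strict order on darts *)

Lemma precedes_irr d : ~ precedes d d.
Proof.
case=> [[|x s]] [] // _ /andP[_ dxs] sd _.
by move: dxs; rewrite map_cons cons_uniq -{1}sd (map_f tgt (mem_last x s)).
Qed.

Lemma simple_from_cat d s t : simple_from d s -> simple_from (last d s) t ->
  {in map tgt t, forall y, y \notin map tgt (d :: s)} -> simple_from d (s ++ t).
Proof.
case/andP=> ps us /andP[pt ut] dis; rewrite /simple_from cat_path ps pt.
rewrite -cat_cons map_cat uniq_catC; apply: cat_uniq_disjoint => //.
by case/andP: ut.
Qed.

(** If [w] leaves [f], it avoids [e :: t], so [t ++ w] is simple from [e] and therefore avoids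
    [d :: s]. *)
Lemma precedes_trans d e f : precedes d e -> precedes e f -> precedes d f.
Proof.
case=> s [s0 ss sd s_out] [t [t0 st te t_out]]; exists (s ++ t); split.
- by rewrite size_cat ltn_addr.
- by apply: simple_from_cat; rewrite ?sd //; apply: s_out.
- by rewrite last_cat sd.
move=> w sw y yw; have := t_out w sw; rewrite -te in sw => w_out.
have := s_out _ (simple_from_cat st sw w_out) y.
rewrite map_cat mem_cat yw orbT -cat_cons map_cat mem_cat negb_or => -> //=.
by have := w_out y yw; rewrite inE negb_or => /andP[].
Qed.


(** * Rerouting a cycle at its first cusp *)

Lemma cycle_from_prefix d p y r : cycle_from d (p ++ y :: r) ->
  uniq (map tgt (d :: p)) /\
  {subset map tgt (d :: p) <= map tgt (p ++ y :: r)}.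
Proof.
case=> _ + _ + _; rewrite !map_cat last_cat cat_uniq => /and3P[up dis _] /= dE.
have dr : tgt d \in map tgt (y :: r) by rewrite -dE (map_f tgt (mem_last y r)).
rewrite up andbT; split; first exact: (hasPn dis).
by move=> v; rewrite inE mem_cat => /predU1P[->|->]; rewrite ?dr ?orbT.
Qed.

(* A path q z leaves the first cusp of the cycle and first meets the cycle after
   that cusp.  Taking it as a shortcut removes the cusps of the skipped part
   y r1; if this does not help, that part has no cusp inside and closes the path
   into a cusp-free cycle. *)
Lemma reroute_forward d p q z y r1 w r2 :
  cycle_from d (p ++ (y :: r1) ++ w :: r2) ->
  path step d p -> cuspidal (last d p) y ->
  path step (last d p) (rcons q z) -> tgt z = tgt (last y r1) ->
  uniq (map tgt q) ->
  {in map tgt q, forall v, v \notin map tgt (p ++ (y :: r1) ++ w :: r2)} ->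
  (exists s, cusp_free_cycle s) \/
  exists s, cycle_from d s /\ cusps d s < cusps d (p ++ (y :: r1) ++ w :: r2).
Proof.
case: p => [|x p]; first by case=> _ _ _ _ /= /andP[/negP+ _].
set c := last d (x :: p); move=> [cl cu _ ct cc] ps cy qs zE uq qdis.
move: cl ct cc; rewrite !cat_path !last_cat -/c [last c _]/= [last _ (w :: r2)]/=.
move=> /and3P[pl r1l wl] ct cc.
have subw : subseq (map tgt (x :: p) ++ tgt z :: map tgt (w :: r2))
    (map tgt ((x :: p) ++ (y :: r1) ++ w :: r2)).
  rewrite !map_cat cat_subseq // -cat1s cat_subseq // sub1seq zE.
  by rewrite (map_f tgt (mem_last y r1)).
have [less|] := ltnP (cusps d ((x :: p) ++ rcons q z ++ w :: r2))
  (cusps d ((x :: p) ++ (y :: r1) ++ w :: r2)).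
  right; exists ((x :: p) ++ rcons q z ++ w :: r2); split=> //; split=> //.
  - rewrite !cat_path pl (path_step_link qs) last_rcons.
    by move: wl; rewrite /= /link zE.
  - rewrite !map_cat map_rcons cat_rcons uniq_catCA.
    apply: cat_uniq_disjoint => //; first exact: (subseq_uniq subw).
    by move=> v /qdis; apply: contra; apply: (mem_subseq subw).
  - by rewrite !last_cat.
  - by rewrite !last_cat.
rewrite !cusps_cat -/c (path_step_cusps ps) (path_step_cusps qs) last_rcons.
rewrite /cusps /= cy -!/(cusps _ _) !add0n add1n addSn addnA => more.
(* The shortcut removes the cusp at [y], those of [r1] and perhaps one before [w], and adds at most
   one, between [z] and [w]. No decrease leaves a single possibility. *)
have {more}[zw r1c rw] :
    [/\ cuspidal z w, cusps y r1 = 0 & ~~ cuspidal (last y r1) w].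
  move: (cuspidal z w) (cuspidal (last y r1) w) (cusps y r1) (cusps w r2) more.
  by clear=> -[] [] m n; split=> //; lia.
left; exists (rcons q z ++ reversal (y :: r1)).
have /andP[yl r1l'] : link c y && path link y r1 by [].
have : sorted step (reversal (y :: r1)).
  by rewrite sorted_step_reversal /= path_step r1c r1l'.
have := map_tgt_reversal (y :: r1).
have [t -> tl] := reversal_ends y r1 => rmap /= ts.
have srcs := map_src r1l.
split.
- by rewrite size_cat size_rcons.
(* The two junctions are cusp-free: [inn z] is [out w], unlike [inn (last y r1)]; and [out y] is
   [inn c], which the first dart of the path avoids. *)
- have: last c (rcons q z) = z by rewrite last_rcons.
  move: qs; rewrite headI; move: (head z q) (behead _) => a s.
  rewrite cycle_cat_cons /= => /andP[/andP[ca nca] ss] lz; rewrite ss lz ts tl /step.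
  rewrite /link /cuspidal src_flip tgt_flip inn_flip out_flip zE eqxx /=.
  rewrite /link /cuspidal in ca nca; rewrite -(eqP yl) -(eqP cy) ca nca andbT.
  by rewrite andbT (eqP zw) eq_sym.
- rewrite map_cat rmap map_rcons cat_rcons.
  have subc : subseq (tgt c :: map tgt (y :: r1))
      (map tgt ((x :: p) ++ (y :: r1) ++ w :: r2)).
    rewrite (lastI x p) cat_rcons -/c !(map_cat, map_cons) -cat_cons.
    by apply: subseq_trans (suffix_subseq _ _); apply: prefix_subseq.
  have srcsE : tgt z :: rev (map src (y :: r1)) =i tgt c :: map tgt (y :: r1).
    by move=> v; rewrite -srcs mem_rcons !inE mem_rev zE.
  apply: cat_uniq_disjoint => //.
    rewrite -rev_rcons rev_uniq zE -[tgt (last y r1)]/(tgt (last c (y :: r1))) srcs.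
    exact: (subseq_uniq subc).
  move=> v /qdis; apply: contra; rewrite srcsE.
  exact: (mem_subseq subc).
Qed.

(* The path q z now first meets the cycle before the cusp, at the source of x:
   either it closes the part x p2 into a cusp-free cycle, or replacing that part
   by the reverse of q z avoids the cusp. *)
Lemma reroute_backward d p1 x p2 q z y r :
  cycle_from d ((p1 ++ x :: p2) ++ y :: r) ->
  path step d (p1 ++ x :: p2) -> cuspidal (last x p2) y ->
  path step (last x p2) (rcons q z) -> tgt z = tgt (last d p1) ->
  uniq (map tgt q) ->
  {in map tgt q, forall v, v \notin map tgt ((p1 ++ x :: p2) ++ y :: r)} ->
  (exists s, cusp_free_cycle s) \/
  exists s, cycle_from d s /\ cusps d s < cusps d ((p1 ++ x :: p2) ++ y :: r).
Proof.
set c := last x p2; move=> /[dup] /cycle_from_prefix[up subp] [cl cu _ ct cc] ps cy qs zE uq qdis.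
have := ps; rewrite cat_path /= => /and3P[p1s /andP[lx nx] p2s].
have := cl; rewrite !(cat_path, last_cat) -/c /= => /andP[_ /andP[yl rl]].
have lz : last c (rcons q z) = z by rewrite last_rcons.
have subz : subseq (tgt z :: map tgt (x :: p2)) (map tgt (d :: p1 ++ x :: p2)).
  rewrite -cat_cons (lastI d p1) cat_rcons map_cat zE.
  exact: suffix_subseq.
case zx: (cuspidal z x); last first.
  left; exists (rcons q z ++ x :: p2); split.
  - by rewrite size_cat size_rcons.
  - move: qs lz; rewrite headI; move: (head z q) (behead _) => a s.
    rewrite cycle_cat_cons /= => /andP[ca ss] lz; rewrite ss lz p2s ca /step zx.
    by rewrite /link zE -/(link _ x) lx.
  - rewrite map_cat map_rcons cat_rcons; apply: cat_uniq_disjoint => //.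
      exact: (subseq_uniq subz).
    by move=> v /qdis; apply: contra => /(mem_subseq subz)/subp.
right; exists (p1 ++ reversal (rcons q z) ++ y :: r).
have rmap := map_tgt_reversal (rcons q z).
have srcq : map src (rcons q z) = tgt c :: map tgt q.
  have := map_src (path_step_link qs).
  by rewrite lz (map_rcons tgt) -rcons_cons => /rcons_inj[].
have := qs; rewrite headI; move: (headI q z).
move: (head z q) (behead _) => a s qE /= /andP[/andP[ca nca] ss].
have [t tE tl] := reversal_ends a s.
have sz : last a s = z by rewrite -lz qE.
(* By [zx], [flip z] leaves with the same colour as [x], so it can take the place of [x] after
   [p1]. *)
have rs : path step (last d p1) (reversal (a :: s)).
  have : sorted step (reversal (a :: s)) by rewrite sorted_step_reversal.
  rewrite tE sz /= => ->; rewrite andbT /step /link /cuspidal src_flip out_flip.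
  by rewrite zE eqxx (eqP zx).
split; last first.
  rewrite !cusps_cat (path_step_cusps p1s) (path_step_cusps rs).
  rewrite last_cat -/c tE /= tl.
  have -> : cusps (last d p1) (x :: p2) = 0.
    move: (path_step_cusps ps); rewrite cusps_cat => /eqP.
    by rewrite addn_eq0 => /andP[_ /eqP].
  (* Now [y] is entered through [flip a], with colour [out a] instead of [inn c]: the cusp at [y]
     disappears. *)
  rewrite /cusps /= -/c cy {1}/cuspidal inn_flip -(eqP cy) eq_sym.
  by move: nca; rewrite /cuspidal => /negPf->.
have rl' : last (last d p1) (reversal (a :: s)) = flip a by rewrite tE.
split.
- rewrite !cat_path (path_step_link p1s) (path_step_link rs) rl' /= rl andbT.
  by rewrite /link tgt_flip -(eqP ca).
- have subc : subseq (map tgt p1 ++ tgt c :: map tgt (y :: r))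
      (map tgt ((p1 ++ x :: p2) ++ y :: r)).
    rewrite -catA (lastI x p2) cat_rcons -/c !map_cat cat_subseq //.
    exact: suffix_subseq.
  rewrite !map_cat -qE rmap srcq.
  rewrite (perm_uniq (s2 := map tgt q ++ map tgt p1 ++ tgt c :: map tgt (y :: r))).
    apply: cat_uniq_disjoint => //; first exact: (subseq_uniq subc).
    by move=> v /qdis; apply: contra; apply: (mem_subseq subc).
  apply/permP => f; rewrite !count_cat count_rev.
  rewrite -(cat1s _ (map tgt q)) -(cat1s _ (map tgt (y :: r))) !count_cat.
  by rewrite -(addnA (count f [:: tgt c])) (addnCA (count f [:: tgt c])) addnCA.
- by rewrite !size_cat addnS addnS.
- by rewrite -ct !last_cat.
- move: cc; rewrite !last_cat /=; case: (p1) => [|x1 p1'] //=.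
  by rewrite tE /= sz /cuspidal out_flip (eqP zx).
Qed.

(** Cut [t] at the first dart [z] ending on the cycle, and ask whether [tgt z] lies on [d :: p] or
    only later. *)
Lemma reroute d p y r t v :
  cycle_from d (p ++ y :: r) -> path step d p -> cuspidal (last d p) y ->
  simple_from (last d p) t -> v \in map tgt t -> v \in map tgt (d :: p) ->
  (exists s, cusp_free_cycle s) \/
  exists s, cycle_from d s /\ cusps d s < cusps d (p ++ y :: r).
Proof.
set s := p ++ y :: r; set c := last d p => cs ps cy st vt vp.
have [up subp] := cycle_from_prefix cs.
have : has [pred x | tgt x \in map tgt s] t.
  by case/mapP: vt vp => x xt -> vp; apply/hasP; exists x => //=; apply: subp.
case/first_in => q [z [t2 [tE /= zs /hasPn q_out]]].
move: st; rewrite tE /simple_from cat_path map_cons map_cat cons_uniq cat_uniq.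
rewrite map_rcons rcons_uniq mem_cat mem_rcons inE !negb_or.
case/andP=> /andP[qs _] /and3P[/andP[/andP[cz _] _] /andP[zq uq] _].
have qdis : {in map tgt q, forall v, v \notin map tgt s}.
  by move=> _ /mapP[x xq ->]; apply: q_out.
have [zp|zp] := boolP (tgt z \in map tgt (d :: p)).
  have [s1 [x [p2 [pE xz]]]] := mem_map_split zp.
  have [p1 [p1E p1l]] : exists p1, p = p1 ++ p2 /\ last d p1 = x.
    case: s1 pE => [|? s1] /= [dE ->]; first by exists [::].
    by exists (rcons s1 x); rewrite last_rcons.
  (* An empty [p2] would put [tgt z] at [tgt c], against the simplicity of [t]. *)
  case: p2 p1E {pE} => [|x2 p2] p1E.
    by move: cz; rewrite /c p1E cats0 p1l xz eqxx.
  have cE : c = last x2 p2 by rewrite /c p1E last_cat.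
  rewrite /s p1E; apply: (@reroute_backward d p1 x2 p2 q z y r);
    rewrite -?p1E -?cE //; by rewrite p1l.
have zr : tgt z \in map tgt (y :: r).
  move: zs; rewrite /s map_cat mem_cat => /orP[zp'|//].
  by rewrite inE zp' orbT in zp.
have [s1 [x [r2 [rE xz]]]] := mem_map_split zr.
have [r1 [r1E r1l]] : exists r1, rcons s1 x = y :: r1 /\ last y r1 = x.
  case: s1 rE => [|y' s1] /= [<- _]; first by exists [::].
  by exists (rcons s1 x); rewrite last_rcons.
(* An empty [r2] would put [tgt z] at the end of the cycle, which is [tgt d]. *)
rewrite r1E in rE; case: r2 rE => [|w r2] rE.
  case: cs => _ _ _ sd _; case/negP: zp.
  by rewrite -xz -r1l inE -sd last_cat rE cats0 eqxx.
rewrite /s rE; apply: (@reroute_forward d p q z y r1 w r2); rewrite -?rE //.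
by rewrite r1l.
Qed.

(** * From a maximal dart to a vertex where every cycle has a cusp *)

Lemma first_cusp d s : path link d s -> path step d s \/
  exists p y r, [/\ s = p ++ y :: r, path step d p & cuspidal (last d p) y].
Proof.
elim: s d => [|x s IHs] d /=; first by left.
case/andP=> dx /IHs xs; have [cdx|cdx] := boolP (cuspidal d x).
  by right; exists [::], x, s.
have sdx : step d x by rewrite /step dx.
case: xs => [->|[p [y [r [-> ps cy]]]]]; first by left; rewrite sdx.
by right; exists (x :: p), y, r; rewrite /= sdx.
Qed.

Lemma cycle_from_precedes d s : cycle_from d s ->
  (exists t, cusp_free_cycle t) \/ exists e, precedes d e.
Proof.
have [n] := ubnP (cusps d s); elim: n s => // n IHn s le_n cs.
have [sl us s0 sd cc] := cs.
case: (first_cusp sl) => [ss|[p [y [r [sE ps cy]]]]].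
  left; exists s; split=> //; case: s ss cc sl sd {us s0 cs le_n} => // x s.
  rewrite (cycle_path x) => /= /andP[_ ->] /andP[_ cl] /andP[dx _] sd.
  by rewrite /step cl /link sd -/(link d x) dx.
(* The first cusp is not at [tgt d], where [cycle_from] forbids one. *)
have p0 : 0 < size p.
  by case: (p) sE cy cc => // -> /= cdy /andP[/negP].
have [no_return|] := pselect (forall t, simple_from (last d p) t ->
    {in map tgt t, forall v, v \notin map tgt (d :: p)}).
  right; exists (last d p), p; split=> //; rewrite /simple_from ps.
  by rewrite sE in cs; case: (cycle_from_prefix cs).
case/existsNP=> t /not_implyP[st /existsNP[v /not_implyP[vt /negP/negPn vp]]].
rewrite sE in cs le_n; case: (reroute cs ps cy st vt vp) => [|[s' [cs' lt]]].
  by left.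
by apply: IHn cs'; apply: leq_trans lt _; rewrite -ltnS.
Qed.

Lemma cycle_from_cycle d x s : cycle link (x :: s) -> uniq (map tgt (x :: s)) ->
  src x = tgt d -> ~~ cuspidal d x -> ~~ cuspidal (last x s) x ->
  cycle_from d (x :: s).
Proof.
rewrite (cycle_path x) => /= /andP[lx xs] us xd cdx clx.
split=> //=; first by rewrite /link xd eqxx.
  by rewrite (eqP lx).
by rewrite cdx.
Qed.

Lemma uniq_tgt_reversal x s : cycle link (x :: s) ->
  uniq (map tgt (reversal (x :: s))) = uniq (map tgt (x :: s)).
Proof.
rewrite (cycle_path x) => /map_src srcE; rewrite map_tgt_reversal rev_uniq.
apply: perm_uniq; rewrite -(perm_cons (tgt (last x (x :: s)))) -srcE.
by rewrite perm_sym perm_rcons.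
Qed.

Lemma exists_cuspidal_vertex (v0 : V) : ~ (exists s, cusp_free_cycle s) ->
  exists v, forall x s, cycle link (x :: s) -> uniq (map tgt (x :: s)) ->
    src x = v -> cuspidal (last x s) x.
Proof.
move=> no_cycle; case: (pickP (@predT D)) => [d0 _|noD]; last first.
  by exists v0 => x; have := noD x.
have [d dmax] := max_strict_order d0 precedes_irr precedes_trans.
have no_cycle_from s : ~ cycle_from d s.
  by case/cycle_from_precedes => // -[e]; apply: dmax.
exists (tgt d) => x s cs us xd; apply: contraT => clx.
have [cdx|cdx] := boolP (cuspidal d x); last first.
  by case: (no_cycle_from (x :: s)); apply: cycle_from_cycle.
(* Here [x] leaves with the colour of [d]; the reversed cycle leaves with [inn (last x s)], another
   colour by [clx]. *)
have [t tE tl] := reversal_ends x s.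
case: (no_cycle_from (reversal (x :: s))); rewrite tE; apply: cycle_from_cycle.
- by rewrite -tE cycle_link_reversal.
- by rewrite -tE uniq_tgt_reversal.
- by move: cs; rewrite (cycle_path x) src_flip => /= /andP[/eqP-> _].
- by move: clx; rewrite /cuspidal out_flip (eqP cdx) eq_sym.
- by rewrite tl /cuspidal inn_flip out_flip eq_sym.
Qed.

End Darts.

(** * Translation between partial graphs and darts *)

Section PartialGraph.

Variables (G : partial_graph) (C : Type) (c : local_coloring G C).

(** An edge with two endpoints gives two darts; any other edge gives none, and no path can use
    it. *)
Definition dart := {x : vertex G * edge G * vertex G |
  (x.1.1 != x.2) && (ends x.1.2 == [set x.1.1; x.2])}.

Definition dsrc (d : dart) := (val d).1.1.
Definition dedge (d : dart) := (val d).1.2.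
Definition dtgt (d : dart) := (val d).2.

Lemma ends_dart d : ends (dedge d) = [set dsrc d; dtgt d].
Proof. by case: d => -[[v e] w] /= i; case/andP: (i) => _ /eqP. Qed.

Lemma dsrc_neq_dtgt d : dsrc d != dtgt d.
Proof. by case: d => -[[v e] w] /= i; case/andP: (i). Qed.

Lemma dflip_proof (d : dart) :
  (dtgt d != dsrc d) && (ends (dedge d) == [set dtgt d; dsrc d]).
Proof. by rewrite eq_sym dsrc_neq_dtgt ends_dart setUC eqxx. Qed.

Definition dflip (d : dart) : dart :=
  exist _ (dtgt d, dedge d, dsrc d) (dflip_proof d).

(** Totalising [c] removes the membership proofs, and [{classic C}] supplies a boolean equality on
    colours. *)
Definition colour (e : edge G) (w : vertex G) : option {classic C} :=
  if @idP (w \in ends e) is ReflectT we then Some (c we : {classic C}) else None.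

Lemma colour_in e w (we : w \in ends e) : colour e w = Some (c we).
Proof.
rewrite /colour; case: {-}_ / idP => [we'|/(_ we)//].
by rewrite (bool_irrelevance we' we).
Qed.

Definition dout (d : dart) := colour (dedge d) (dsrc d).
Definition dinn (d : dart) := colour (dedge d) (dtgt d).

Notation dlink := (link dsrc dtgt).
Notation dcuspidal := (cuspidal dout dinn).
Notation dstep := (step dsrc dtgt dout dinn).

Lemma cuspP (d d' : dart) : dlink d d' ->
  cusp c (dedge d) (dtgt d) (dedge d') <-> dedge d <> dedge d' /\ dcuspidal d d'.
Proof.
move=> /eqP dd'; rewrite /cuspidal /dinn /dout -dd'; split.
  by case=> ne [we [wf E]]; split=> //; rewrite !colour_in E.
have we : dtgt d \in ends (dedge d) by rewrite ends_dart !inE eqxx orbT.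
have wf : dtgt d \in ends (dedge d') by rewrite ends_dart dd' !inE eqxx.
by case=> ne; rewrite !colour_in => /eqP[E]; split=> //; exists we, wf.
Qed.

Definition steps_of (s : seq dart) := [seq (dedge d, dtgt d) | d <- s].

Lemma path_from_darts v s : path_from v s -> exists ds,
  [/\ steps_of ds = s, sorted dlink ds &
      if ds is d :: _ then dsrc d = v else True].
Proof.
elim: s v => [|[e w] s IHs] v /=; first by exists [::].
case/and3P=> vw ew /IHs[ds [<- ds_sorted ds_src]].
have vew : ((v, e, w).1.1 != (v, e, w).2) &&
    (ends (v, e, w).1.2 == [set (v, e, w).1.1; (v, e, w).2]) by rewrite vw ew.
exists (exist _ (v, e, w) vew :: ds); split=> //.
by case: ds ds_sorted ds_src => //= d ds -> dw; rewrite /link dw eqxx.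
Qed.

Lemma path_from_steps_of d ds : sorted dlink (d :: ds) ->
  path_from (dsrc d) (steps_of (d :: ds)).
Proof.
elim: ds d => [|d' ds IHds] d; rewrite /= dsrc_neq_dtgt ends_dart eqxx //=.
by case/andP=> /eqP-> /IHds.
Qed.

Lemma corners_cat s1 e w f w' s2 :
  (e, w, f) \in @corners G (s1 ++ (e, w) :: (f, w') :: s2).
Proof.
elim: s1 => [|[e1 w1] s1 IHs] /=; first by rewrite inE eqxx.
by case: s1 IHs => [|[e2 w2] s1] IHs /=; rewrite inE; move: IHs => /= ->; rewrite orbT.
Qed.

Lemma cornersP (r : rel dart) d ds e w f : path r d ds ->
  (e, w, f) \in @corners G (steps_of (d :: ds)) ->
  exists d1 d2, [/\ r d1 d2, e = dedge d1, w = dtgt d1 & f = dedge d2].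
Proof.
elim: ds d => // d' ds IHds d /= /andP[rd rds]; rewrite inE.
by case/predU1P=> [[-> -> ->]|/(IHds _ rds)//]; exists d, d'.
Qed.

Lemma cycle_corners_steps_of v d ds :
  cycle_corners (AltSeq v (steps_of (d :: ds))) =
  corners (steps_of (rcons (d :: ds) d)).
Proof. by rewrite /steps_of map_rcons. Qed.

(* Two darts of the cycle with the same edge would be opposite, and the
   second one would be followed by the first one, making a cusp. *)
Lemma uniq_dedge s : cycle dstep s -> uniq (map dtgt s) -> uniq (map dedge s).
Proof.
move=> cs us; rewrite map_inj_in_uniq ?(map_uniq us) // => x y xs ys xy.
apply/eqP/contraT => nxy; have := ends_dart x; rewrite xy ends_dart => E.
have txy : dtgt x != dtgt y.
  by apply: contra nxy => /eqP/(uniq_map_inj us xs ys)->.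
have yx : dtgt y = dsrc x.
  have: dtgt y \in [set dsrc x; dtgt x] by rewrite -E !inE eqxx orbT.
  by rewrite !inE (eq_sym _ (dtgt x)) (negPf txy) orbF => /eqP.
have /andP[/eqP lpx] := prev_cycle cs xs.
rewrite -yx in lpx; rewrite (uniq_map_inj us _ ys lpx) ?mem_prev //.
by rewrite /cuspidal /dinn /dout -yx xy eqxx.
Qed.

Lemma is_cycle_steps_of d ds : cycle dstep (d :: ds) ->
  uniq (map dtgt (d :: ds)) ->
  is_cycle (AltSeq (dsrc d) (steps_of (d :: ds))) /\
  cusp_free c (AltSeq (dsrc d) (steps_of (d :: ds))).
Proof.
set s := d :: ds; set p := AltSeq _ _ => cs us.
have targets : [seq x.2 | x <- steps p] = map dtgt s by rewrite -map_comp.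
have edgesE : edges p = map dedge s by rewrite /edges -map_comp.
have size_p : size (steps p) = size s by rewrite size_map.
have := cs; rewrite (cycle_path d) => sls.
have lastE : dtgt (last d ds) = dsrc d by case/andP: sls => /andP[/eqP].
split; last first.
  case=> w [e [f []]]; rewrite cycle_corners_steps_of.
  case/(cornersP cs) => d1 [d2 [/andP[l12 n12] -> -> ->]] /(cuspP l12)[_].
  exact/negP.
split=> //.
- apply: path_from_steps_of; apply: (@path_sorted _ _ (last d s)).
  by apply: sub_path sls => x y /andP[].
- split; first by rewrite edgesE uniq_dedge.
  move=> i [//|j]; rewrite size_p /vertices targets => ij js.
  (* The source is also the last target, and targets are distinct, so meeting it again forces the
     last index. *)
  case: i ij => [_|i ij] /=.
    rewrite -[dsrc d]lastE -(last_map dtgt) (last_nth (dtgt d)) size_map.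
    rewrite -[_ :: _]/(map dtgt s) (set_nth_default (dtgt d)) ?size_map //.
    by move/eqP; rewrite nth_uniq ?size_map // => /eqP <-.
  rewrite -[_ :: _]/(map dtgt s) => /eqP; rewrite nth_uniq ?size_map //; last exact: leq_trans (ltnW ij) js.
  by move/eqP => E; rewrite E ltnn in ij.
- by rewrite /target targets /= last_map lastE.
Qed.

Lemma splitting_dtgt v :
  (forall d ds, cycle dlink (d :: ds) -> uniq (map dtgt (d :: ds)) ->
     dsrc d = v -> dcuspidal (last d ds) d) -> splitting c v.
Proof.
move=> vP [u st] [] /path_from_darts[ds [/= <- ds_sorted ds_src]].
case: ds ds_sorted ds_src => [|d0 ds] // ds_sorted <- {u st}.
set s := d0 :: ds; set p := AltSeq _ _ => -[edges_uniq simple_p] pu _.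
have targets : [seq x.2 | x <- steps p] = map dtgt s by rewrite -map_comp.
have edgesE : edges p = map dedge s by rewrite /edges -map_comp.
have size_p : size (steps p) = size s by rewrite size_map.
move: pu; rewrite /target targets /= last_map => lastE.
have us : uniq (map dtgt s).
  apply/(uniqP (dsrc d0)) => i j; rewrite !inE size_map => si sj E.
  wlog ij : i j si sj E / i < j.
    by move=> H; case: (ltngtP i j) => // /H => [->|/(_ sj si (esym E))->].
  (* Target [i] is vertex [i.+1], so the exception at index 0 cannot occur. *)
  have [] // := simple_p i.+1 j.+1.
    by rewrite size_p.
  by rewrite /vertices targets.
have cs : cycle dlink s.
  by rewrite (cycle_path d0) /= /link -lastE eqxx.
rewrite /vertices targets => vs.
have {vs} : v \in map dtgt s.
  move: vs; rewrite in_cons [source p]lastE => /predU1P[->|//].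
  by rewrite (map_f dtgt (mem_last d0 ds)).
case/mem_map_split=> s1 [d [s2 [sE dv]]].
(* Rotate the cycle to start just after the dart [d] that ends at [v]. *)
have rotE : rot (size (rcons s1 d)) s = s2 ++ rcons s1 d by rewrite sE rot_size_cat.
have := cs; rewrite -(rot_cycle (size (rcons s1 d))) rotE.
have := us; rewrite -(rot_uniq (size (rcons s1 d))) -map_rot rotE.
rewrite edgesE -(rot_uniq (size (rcons s1 d))) -map_rot rotE in edges_uniq.
move: edges_uniq; rewrite -rcons_cat.
have [x [s' xE]] : exists x s', rcons (s2 ++ s1) d = x :: s'.
  by case: (s2 ++ s1) => [|x s']; do 2 eexists.
rewrite xE => eu xu xc.
have lx : last x s' = d by rewrite -[LHS](last_cons d) -xE last_rcons.
have dx : dlink d x by move: xc; rewrite (cycle_path d) /= lx => /andP[].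
have dcx : dcuspidal d x.
  by rewrite -lx; apply: vP => //; rewrite -dv; apply/esym/eqP.
(* Edges are distinct along the cycle, and a cycle of one dart would be a loop. *)
have ndx : dedge d <> dedge x.
  case: s' lx eu {xE xu xc} => [|y s'] /= lx eu.
    by move: dx; rewrite lx /link eq_sym (negPf (dsrc_neq_dtgt d)).
  case/andP: eu => /negP eu _ E; apply: eu.
  by rewrite -E -lx (map_f dedge (mem_last y s')).
exists (dedge d), (dedge x); rewrite -dv; split; last exact/(cuspP dx).
rewrite cycle_corners_steps_of -/s.
(* If [s2] is empty, [x] is the repeated first dart [d0]. *)
have [t ->] : exists t, rcons s d0 = s1 ++ d :: x :: t.
  rewrite sE cat_rcons rcons_cat /=; case: s2 sE xE {rotE} => [|y s2] /= sE.
    rewrite cats0 in sE; rewrite -sE => -[-> _].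
    by exists [::].
  by case=> -> _; exists (rcons s2 d0).
by rewrite /steps_of map_cat corners_cat.
Qed.

End PartialGraph.

Theorem theorem4p1 (G : partial_graph) (C : Type) (c : local_coloring G C)
    (hV : 0 < #|vertex G|)
    (hfree : ~ exists p : altseq G, is_cycle p /\ cusp_free c p) :
  exists v : vertex G, splitting c v.
Proof.
have [v0 _] : exists v0 : vertex G, v0 \in vertex G by apply/card_gt0P.
have [|v vP] := @exists_cuspidal_vertex _ _ _ (@dsrc G) (@dtgt G) (dout c) (dinn c)
  (@dflip G) (fun=> erefl) (fun=> erefl) (fun=> erefl) (fun=> erefl) v0.
  case=> -[|d ds] [] // _ cds uds; apply: hfree.
  by eexists; apply: is_cycle_steps_of cds uds.
by exists v; apply: splitting_dtgt.
Qed.
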